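(* Let $Z_1^*=X_{a_2}/V_2$, let $W\sim \mathrm{Gamma}(b_2-a_2+2,1)$ and let $\beta_1^*$ be the unique solution of $E L'(W\beta_1^* )=0$. If $\beta_1^*<c_{02}$, then the estimator $$\delta_{2S2}=\begin{cases}\min\{c_{02},\ \beta_1^*(1+(n_2-a_2+1)Z_1^* )\}V_2, & Z_1^*>0,\\ c_{02}V_2, & \text{otherwise,}\end{cases}$$ of $\sigma_2$ dominates $\delta_{02}=c_{02}V_2$ under the scale invariant loss $L$.
   Context: Fix integers $1\le a_i<b_i\le n_i$, $i=1,2$. The unknown parameter is $\theta=(\mu_1,\mu_2,\sigma_1,\sigma_2)$ with $\mu_1,\mu_2\in\mathbb{R}$ and $0<\sigma_1\le\sigma_2$. From a random sample of size $n_i$ from the exponential distribution with density $\sigma_i^{-1}e^{-(x-\mu_i)/\sigma_i}$, $x>\mu_i$, one observes only the order statistics of ranks $a_i,\dots,b_i$ (doubly type-II censored sample). A complete sufficient statistic is $(X_{a_1},X_{a_2},V_1,V_2)$, consisting of four independent random variables, where $X_{a_i}$ has density $$\frac{n_i!}{(a_i-1)!(n_i-a_i)!}\Big[1-e^{-\frac{x-\mu_i}{\sigma_i}}\Big]^{a_i-1}\frac1{\sigma_i}\Big[e^{-\frac{x-\mu_i}{\sigma_i}}\Big]^{n_i-a_i+1},\quad x>\mu_i,$$ and $V_i$ has the gamma distribution with shape $b_i-a_i$ and scale $\sigma_i$. $\mathrm{Gamma}(k,1)$ denotes the gamma distribution with shape $k$ and scale $1$. The loss for estimating $\sigma_2$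 by $\delta$ is $L(\delta/\sigma_2)$, where $L$ is differentiable and: (i) $L(t)$ is bowl-shaped with minimum value $0$ attained at $t=1$, decreasing for $t\le1$ and increasing for $t\ge1$; (ii) all integrals involving $L$ are finite and differentiation under the integral sign is permissible. The risk is $R(\theta,\delta)=E_\theta L(\delta/\sigma_2)$. An estimator $\delta$ dominates $\delta'$ if $R(\theta,\delta)\le R(\theta,\delta')$ for all $\theta$, with strict inequality for at least one $\theta$. The best affine equivariant estimator (BAEE) of $\sigma_2$ is $\delta_{02}=c_{02}V_2$, where $c_{02}$ is the unique solution of $E_{\sigma_2=1}\big(L'(c_{02}V_2)V_2\big)=0$. *)

(* Defs.v *)
From HB Require Import structures.
From mathcomp Require Import all_boot all_order all_algebra.
From mathcomp Require Import all_classical all_reals all_analysis.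
Set Implicit Arguments.
Unset Strict Implicit.
Unset Printing Implicit Defensive.
Import Order.TTheory GRing.Theory Num.Theory numFieldNormedType.Exports.
Local Open Scope classical_set_scope.
Local Open Scope ring_scope.

Record param (R : realType) := Param {
  mu1 : R;
  mu2 : R;
  sigma1 : R;
  sigma2 : R;
  sigma1_gt0 : 0 < sigma1;
  sigma1_le_sigma2 : sigma1 <= sigma2 }.

(* Density of the order statistic of rank a in a sample of size n from the
   exponential distribution with location mu and scale sigma (1 <= a <= n). *)
Definition order_stat_pdf (R : realType) (n a : nat) (mu sigma x : R) : R :=
  if mu < x then
    n`!%:R / ((a - 1)`!%:R * (n - a)`!%:R)
    * (1 - expR (- ((x - mu) / sigma))) ^+ (a - 1)
    * sigma^-1 * expR (- ((x - mu) / sigma)) ^+ (n - a + 1)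
  else 0.

(* Only integer shapes k >= 1 occur, so that Gamma(k) = (k - 1)!. *)
Definition gamma_pdf (R : realType) (k : nat) (sigma x : R) : R :=
  if 0 < x then
    x ^+ (k - 1) * expR (- (x / sigma)) / ((k - 1)`!%:R * sigma ^+ k)
  else 0.

Definition has_pdf (d : measure_display) (T : measurableType d) (R : realType)
    (P : probability T R) (X : T -> R) (f : R -> R) : Prop :=
  forall A : set R, measurable A ->
    P (X @^-1` A) = (\int[lebesgue_measure]_(x in A) (f x)%:E)%E.

Definition mutually_independent (d : measure_display) (T : measurableType d)
    (R : realType) (P : probability T R) (I : finType) (X : I -> T -> R)
    : Prop :=
  forall (J : {set I}) (A : I -> set R), (forall i, measurable (A i)) ->
    P (\bigcap_(i in [set` J]) (X i @^-1` A i))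
    = (\prod_(i in J) P (X i @^-1` A i))%E.

(* The family P of laws, indexed by the parameter, makes (X1, X2, V1, V2)
   the sufficient statistic of the two doubly type-II censored samples. *)
Definition censored_model (d : measure_display) (T : measurableType d)
    (R : realType) (n1 a1 b1 n2 a2 b2 : nat)
    (P : param R -> probability T R) (X1 X2 V1 V2 : T -> R) : Prop :=
  forall th : param R,
    [/\ mutually_independent (P th) (tnth [tuple X1; X2; V1; V2]),
        has_pdf (P th) X1 (order_stat_pdf n1 a1 (mu1 th) (sigma1 th)),
        has_pdf (P th) X2 (order_stat_pdf n2 a2 (mu2 th) (sigma2 th)),
        has_pdf (P th) V1 (gamma_pdf (b1 - a1) (sigma1 th)) &
        has_pdf (P th) V2 (gamma_pdf (b2 - a2) (sigma2 th))].

(* E g(V) for V ~ Gamma(k, 1). As gamma_pdf vanishes on ]-oo, 0], only the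
   values of g on ]0, +oo[ matter. *)
Definition gamma_mean (R : realType) (k : nat) (g : R -> R) : R :=
  \int[lebesgue_measure]_x (g x * gamma_pdf k 1 x).

Definition gamma_integrable (R : realType) (k : nat) (g : R -> R) : Prop :=
  (@lebesgue_measure R).-integrable setT
    (fun x => (g x * gamma_pdf k 1 x)%:E).

(* The loss is a function on ]0, +oo[ (as for t - ln t - 1); its values
   elsewhere are unconstrained. Monotonicity is not required to be strict. *)
Definition bowl_shaped (R : realType) (L : R -> R) : Prop :=
  [/\ L 1 = 0,
      (forall s t, 0 < s -> s <= t -> t <= 1 -> L t <= L s) &
      (forall s t, 1 <= s -> s <= t -> L s <= L t)].

(* Finiteness of the integrals of L, and differentiation under the integral
   sign, for the laws Gamma(k, 1) with k >= k0. For k0 the shape of V2, the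
   equations defining c02 and beta involve k = k0 and k = k0 + 1, since
   E L'(W c) with W ~ Gamma(k + 1, 1) is E (L'(V c) V) / k with
   V ~ Gamma(k, 1). *)
Definition gamma_regular (R : realType) (k0 : nat) (L : R -> R) : Prop :=
  forall (k : nat) (c : R), (k0 <= k)%N -> 0 < c ->
    [/\ gamma_integrable k (fun v => L (c * v)),
        gamma_integrable k (fun v => derive1 L (c * v) * v) &
        is_derive c 1 (fun c' => gamma_mean k (fun v => L (c' * v)))
          (gamma_mean k (fun v => derive1 L (c * v) * v))].

Definition unique_pos_root (R : realType) (F : R -> R) (c : R) : Prop :=
  [/\ 0 < c, F c = 0 & forall c', 0 < c' -> F c' = 0 -> c' = c].

Definition risk (d : measure_display) (T : measurableType d) (R : realType)
    (P : param R -> probability T R) (L : R -> R) (th : param R)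
    (delta : T -> R) : \bar R :=
  ('E_(P th)[(fun w => L (delta w / sigma2 th))%R])%E.

Definition dominates (d : measure_display) (T : measurableType d)
    (R : realType) (P : param R -> probability T R) (L : R -> R)
    (delta delta' : T -> R) : Prop :=
  (forall th, (risk P L th delta <= risk P L th delta')%E) /\
  (exists th, (risk P L th delta < risk P L th delta')%E).

Definition delta_02 (T : Type) (R : realType) (c02 : R) (V2 : T -> R)
    : T -> R :=
  fun w => c02 * V2 w.

Definition delta_2S2 (T : Type) (R : realType) (n2 a2 : nat) (c02 beta : R)
    (X2 V2 : T -> R) : T -> R :=
  fun w => let Z := X2 w / V2 w in
    if 0 < Z then
      Num.min c02 (beta * (1 + (n2 - a2 + 1)%:R * Z)) * V2 w
    else c02 * V2 w.

(* Main.v *)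
(* Put [k = b2 - a2] and, given [Z = X2 / V2 = z > 0], let [q = 1 + m z] with
   [m = n2 - a2 + 1]. Conditionally on [Z = z], the density of
   [U = q V2 / sigma2] is proportional to the Gamma(k + 1, 1) density times a
   nondecreasing weight, so the conditional risk of [x q V2] is a weighted mean
   of [L (x U)]. Since [L] is bowl-shaped, [L (c U) - L (b U)] with [b <= c]
   changes sign once, from negative to positive, so a nondecreasing weight can
   only help the smaller multiplier. It remains to see that the unweighted mean
   [G c = E L (c U)] increases on [beta, +oo[: its derivative vanishes only at
   [beta], and a dilation shows that it is nonnegative beyond [beta]. Hence
   replacing [c02] by [beta q] whenever the latter is smaller lowers the
   conditional risk for each [z]. *)
Require Import Defs.
From mathcomp Require Import all_boot all_order all_algebra.
From mathcomp Require Import all_classical all_reals all_analysis.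
From mathcomp Require Import measurable_realfun ring lra.
Import Order.TTheory GRing.Theory Num.Theory numFieldNormedType.Exports.
Local Open Scope classical_set_scope.
Local Open Scope ring_scope.

(** * Integration *)

Section integration.
Import HBNNSimple.
Local Open Scope ereal_scope.

(* No measurability is required, since the integral of a nonnegative function
   is a supremum over the simple functions below it. *)
Lemma ge0_integral_off_null {d} {T : measurableType d} {R : realType}
    (mu : {measure set T -> \bar R}) (N : set T) (f g : T -> \bar R) :
  measurable N -> mu N = 0 ->
  (forall x, 0 <= f x) -> (forall x, 0 <= g x) ->
  (forall x, ~ N x -> f x = g x) -> \int[mu]_x f x = \int[mu]_x g x.
Proof.
move=> mN N0.
wlog suff le_fg : f g / (forall x, 0 <= f x) -> (forall x, 0 <= g x) ->
    (forall x, ~ N x -> f x = g x) -> \int[mu]_x f x <= \int[mu]_x g x.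
  move=> f0 g0 fg; apply/eqP; rewrite eq_le !le_fg// => x Nx.
  by rewrite fg.
move=> f0 g0 fg; rewrite !ge0_integralTE//.
apply: ge_ereal_sup => _ [h /= hf <-].
pose hN := proj_nnsfun h (measurableC mN).
have hNE x : hN x = (h \_ (~` N)) x by rewrite (mrestrict h (measurableC mN)).
apply: ereal_sup_ubound; exists hN.
  move=> x; rewrite hNE patchE.
  by case: ifPn => // xN; rewrite -fg//; move: xN; rewrite inE.
rewrite -[LHS]integralT_nnsfun -[RHS]integralT_nnsfun.
rewrite (ge0_negligible_integral mN)//; last 2 first.
- by apply/measurable_EFinP.
- by move=> x _; rewrite lee_fin.
rewrite [RHS](ge0_negligible_integral mN)//; last 2 first.
- by apply/measurable_EFinP.
- by move=> x _; rewrite lee_fin.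
apply: eq_integral => x; rewrite in_setD => /andP[_ xN].
by rewrite hNE patchE in_setC xN.
Qed.

(** The loss may be non-measurable on nonpositive arguments, and this is what allows it to be
    changed there. Positive and negative parts are compared separately. *)
Lemma integral_off_null {d} {T : measurableType d} {R : realType}
    (mu : {measure set T -> \bar R}) (N : set T) (f g : T -> \bar R) :
  measurable N -> mu N = 0 -> (forall x, ~ N x -> f x = g x) ->
  \int[mu]_x f x = \int[mu]_x g x.
Proof.
move=> mN N0 fg; rewrite integralE [RHS]integralE.
by congr (_ - _); apply: (ge0_integral_off_null mu N) => //= x Nx;
  rewrite !(funeposE, funenegE) fg.
Qed.

(** Both sides pass to the limit along simple functions increasing to [f]; for these, linearity
    reduces the claim to indicators, where it is the hypothesis on [nu]. *)
Lemma ge0_integral_density {d} {T : measurableType d} {R : realType}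
    (mu nu : {measure set T -> \bar R}) (p : T -> R) (f : T -> \bar R) :
  measurable_fun setT p -> (forall x, 0 <= p x)%R ->
  (forall A, measurable A -> nu A = \int[mu]_(x in A) (p x)%:E) ->
  measurable_fun setT f -> (forall x, 0 <= f x) ->
  \int[nu]_x f x = \int[mu]_x (f x * (p x)%:E).
Proof.
move=> mp p0 nuE mf f0.
have mpE : measurable_fun setT (EFin \o p) by exact/measurable_EFinP.
pose h := nnsfun_approx measurableT mf.
have hf x : (h n x)%:E @[n --> \oo] --> f x by apply: cvg_nnsfun_approx.
have -> : \int[nu]_x f x = lim (\int[nu]_x (h n x)%:E @[n --> \oo]).
  rewrite -monotone_convergence//.
  - by apply: eq_integral => x _; apply/esym/cvg_lim.
  - by move=> n; apply/measurable_EFinP.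
  - by move=> n x _; rewrite lee_fin.
  - by move=> x _ a b ab; rewrite lee_fin; exact/lefP/nd_nnsfun_approx.
have -> : \int[mu]_x (f x * (p x)%:E) =
    lim (\int[mu]_x ((h n x)%:E * (p x)%:E) @[n --> \oo]).
  rewrite -monotone_convergence//.
  - apply: eq_integral => x _; apply/esym/cvg_lim => //.
    exact: cvgeZr.
  - by move=> n; apply: emeasurable_funM => //; apply/measurable_EFinP.
  - by move=> n x _; rewrite mule_ge0// lee_fin.
  - move=> x _ a b ab; apply: lee_wpmul2r; rewrite lee_fin//.
    exact/lefP/nd_nnsfun_approx.
suff suf n : \int[nu]_x (h n x)%:E = \int[mu]_x ((h n x)%:E * (p x)%:E).
  by under eq_fun do rewrite suf.
under eq_integral do rewrite fimfunE -fsumEFin//.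
rewrite ge0_integral_fsum//; last 2 first.
- by move=> r; apply/measurable_EFinP/measurable_funM.
- by move=> r x _; exact: nnfun_muleindic_ge0.
transitivity (\int[mu]_x (\sum_(y \in range (h n))
    ((y * \1_(h n @^-1` [set y]) x)%:E * (p x)%:E))); last first.
  apply: eq_integral => x _.
  rewrite -ge0_mule_fsuml => [|y]; last exact: nnfun_muleindic_ge0.
  by rewrite fsumEFin// -(fimfunE _ x).
rewrite ge0_integral_fsum//; last 2 first.
- move=> y; apply: emeasurable_funM => //.
  by apply/measurable_EFinP/measurable_funM.
- move=> y x _; apply: mule_ge0; last by rewrite lee_fin.
  exact: nnfun_muleindic_ge0.
apply: eq_fsbigr => r; rewrite inE => -[t _ rE].
have r0 : (0 <= r)%R by rewrite -rE.
under eq_integral do rewrite EFinM.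
under [RHS]eq_integral do rewrite EFinM -muleA.
rewrite ge0_integralZl//; last exact/measurable_EFinP.
rewrite ge0_integralZl//; last 2 first.
- by apply: emeasurable_funM => //; exact/measurable_EFinP.
- by move=> x _; rewrite mule_ge0// lee_fin.
congr (_ * _); rewrite integral_indic// setIT nuE//.
rewrite integral_mkcond; apply: eq_integral => x _.
by rewrite muleC epatch_indic.
Qed.

End integration.

(** * Dilations of Lebesgue measure *)

Section scaling.
Context {R : realType}.
Local Notation mu := (@lebesgue_measure R).
Local Open Scope ereal_scope.

(** By uniqueness of Lebesgue measure, checked on half-open intervals, it is [c] times its image
    under the dilation by [c]. *)
Lemma ge0_integral_scale (c : R) (f : R -> \bar R) : (0 < c)%R ->
  measurable_fun setT f -> (forall x, 0 <= f x) ->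
  \int[mu]_x f (c * x)%R = c^-1%:E * \int[mu]_x f x.
Proof.
move=> c0 mf f0.
have ci0 : (0 <= c^-1)%R by rewrite invr_ge0 ltW.
pose phi : R -> measurableTypeR R := fun x => (c * x)%R.
have mphi : measurable_fun setT phi by exact: mulrl_measurable.
pose nu_ := mscale (NngNum (ltW c0)) (pushforward mu phi).
pose nu : {measure set (measurableTypeR R) -> \bar R} := nu_ mphi.
have nuE A : measurable A -> mu A = nu A.
  move=> mA; apply: lebesgue_measure_unique => //= _ [[a b] _ <-].
  rewrite /nu/= /mscale/= /pushforward/=.
  rewrite (_ : phi @^-1` _ = `](a / c)%R, (b / c)%R]%classic); last first.
    apply/seteqP; split => x /=; rewrite !in_itv/= /phi ltr_pdivrMr//
      ler_pdivlMr// mulrC//.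
  rewrite !lebesgue_measure_itv/= !lte_fin ltr_pM2r ?invr_gt0//.
  case: ifPn => // _; last by rewrite mule0.
  by rewrite -EFinB -EFinM -mulrBl mulrC divfK// gt_eqF.
transitivity (\int[pushforward mu phi]_x f x).
  by rewrite ge0_integral_pushforward.
rewrite [in RHS](eq_measure_integral nu); last first.
  by move=> A mA _; exact: nuE.
rewrite ge0_integral_mscale//= muleA -EFinM mulVf ?mul1e//.
by rewrite gt_eqF.
Qed.

Lemma integrable_scale (c : R) (f : R -> \bar R) : (0 < c)%R ->
  mu.-integrable setT f -> mu.-integrable setT (fun x => f (c * x)%R).
Proof.
move=> c0 /integrableP[mf foo]; apply/integrableP; split.
  by apply: measurableT_comp => //; exact: mulrl_measurable.
rewrite (ge0_integral_scale c (fun x => `|f x|))//; last first.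
  exact: measurableT_comp.
by rewrite lte_mul_pinfty// lee_fin invr_ge0 ltW.
Qed.

Lemma integral_scale (c : R) (f : R -> \bar R) : (0 < c)%R ->
  mu.-integrable setT f ->
  \int[mu]_x f (c * x)%R = c^-1%:E * \int[mu]_x f x.
Proof.
move=> c0 intf; have mf := measurable_int mu intf.
rewrite integralE [in RHS]integralE muleBr//; last exact: integrable_add_def.
congr (_ - _); rewrite -ge0_integral_scale//.
- by apply: eq_integral => x _; rewrite !funeposE.
- exact: measurable_funepos.
- by apply: eq_integral => x _; rewrite !funenegE.
- exact: measurable_funeneg.
Qed.

End scaling.

(** * Joint law of two independent variables with densities *)

Section joint_law.
Context {d : measure_display} {T : measurableType d} {R : realType}.
Variable P : probability T R.
Local Notation mu := (@lebesgue_measure R).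

Lemma mutually_independent_pair (I : finType) (X : I -> T -> R) (i j : I)
    (A B : set R) : i != j -> mutually_independent P X ->
  measurable A -> measurable B ->
  P (X i @^-1` A `&` X j @^-1` B) = (P (X i @^-1` A) * P (X j @^-1` B))%E.
Proof.
move=> ij indX mA mB.
have ji : (j == i) = false by rewrite eq_sym (negbTE ij).
have mAB l : measurable (if l == i then A else B) by case: ifP.
have := indX [set i; j]%SET _ mAB.
rewrite big_setU1/= ?inE//= big_set1 eqxx ji => <-.
apply: (congr1 P); apply/seteqP; split => w /=.
- move=> [Aw Bw] l /=; rewrite !inE => /orP[/eqP->|/eqP->]; rewrite ?eqxx//.
  by rewrite ji.
- move=> h; split.
    by have := h i; rewrite /= !inE eqxx; apply.
  by have := h j; rewrite /= !inE eqxx orbT ji; apply.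
Qed.

Local Open Scope ereal_scope.

Lemma ge0_integral_pdf (X : {RV P >-> R}) (f : R -> R) (F : R -> \bar R) :
  measurable_fun setT f -> (forall x, 0 <= f x)%R -> has_pdf P X f ->
  measurable_fun setT F -> (forall x, 0 <= F x) ->
  \int[distribution P X]_x F x = \int[mu]_x (F x * (f x)%:E).
Proof.
move=> mf f0 Xf mF F0.
pose X' : T -> measurableTypeR R := X.
have mX' : measurable_fun setT X' by exact: (measurable_funPT X).
pose nu_ := pushforward P X' : {measure set (measurableTypeR R) -> \bar R}.
rewrite ge0_integral_distribution// -(ge0_integral_density mu (nu_ mX'))//.
by rewrite ge0_integral_pushforward.
Qed.

(** Independence on rectangles identifies the joint law with the product of the marginals, and
    Tonelli's theorem puts [Y] in the outer integral. *)
Lemma ge0_integral_indep_pdf (X Y : {RV P >-> R}) (f g : R -> R)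
    (F : R * R -> \bar R) :
  measurable_fun setT f -> (forall x, 0 <= f x)%R ->
  measurable_fun setT g -> (forall y, 0 <= g y)%R ->
  has_pdf P X f -> has_pdf P Y g ->
  (forall A B, measurable A -> measurable B ->
    P (X @^-1` A `&` Y @^-1` B) = P (X @^-1` A) * P (Y @^-1` B)) ->
  measurable_fun setT F -> (forall z, 0 <= F z) ->
  \int[P]_w F (X w, Y w) =
  \int[mu]_y ((\int[mu]_x (F (x, y) * (f x)%:E)) * (g y)%:E).
Proof.
move=> mf f0 mg g0 Xf Yg indXY mF F0.
pose XY w := (X w, Y w).
have mXY : measurable_fun setT XY by exact/measurable_fun_pair.
transitivity (\int[pushforward P XY]_z F z).
  by rewrite ge0_integral_pushforward.
transitivity (\int[distribution P X \x distribution P Y]_z F z).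
  apply: eq_measure_integral => //= A mA _; apply/esym.
  exact: product_measure_unique.
rewrite fubini_tonelli2// (ge0_integral_pdf Y g _ mg g0 Yg)//; last 2 first.
- exact: measurable_fun_fubini_tonelli_G.
- by move=> y; apply: integral_ge0 => x _.
apply: eq_integral => y _; congr (_ * _).
apply: (ge0_integral_pdf X f (fun x => F (x, y)) mf f0 Xf) => //.
exact: measurableT_comp.
Qed.

End joint_law.

(** * Gamma and order statistic densities *)

Section densities.
Context {R : realType}.
Local Notation mu := (@lebesgue_measure R).

Lemma measurable_funV {d} {T : measurableType d} (f : T -> R) :
  measurable_fun setT f -> measurable_fun setT (fun x => (f x)^-1).
Proof.
move=> mf; apply: measurableT_comp => //.
(* This formula also holds at 0, where the inverse is 0 by convention; the base [x ^+ 2] is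
   nonnegative, as [powR_inv1] requires. *)
have -> : (@GRing.inv R) = fun x => x * (x ^+ 2) `^ (-1).
  apply/funext => x; rewrite powR_inv1 ?sqr_ge0//.
  have [->|x0] := eqVneq x 0; first by rewrite invr0 mul0r.
  by field.
apply: measurable_funM => //.
apply: (@measurableT_comp _ _ _ R R R (fun y => y `^ (-1)) setT
  (fun x => x ^+ 2)); first exact: measurable_powR.
exact: measurable_funX.
Qed.

Lemma measurable_order_stat_pdf (n a : nat) (m s : R) :
  measurable_fun setT (order_stat_pdf n a m s).
Proof.
have mexp : measurable_fun setT (fun x : R => expR (- ((x - m) / s))).
  apply: measurableT_comp => //; apply: measurableT_comp => //.
  by apply: measurable_funM => //; exact: measurable_funB.
apply: measurable_fun_ifT => //; first exact: measurable_fun_ltr.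
apply: measurable_funM; last exact: measurable_funX.
apply: measurable_funM => //; apply: measurable_funM => //.
by apply: measurable_funX; exact: measurable_funB.
Qed.

Lemma order_stat_pdf_ge0 (n a : nat) (m s x : R) : 0 < s ->
  0 <= order_stat_pdf n a m s x.
Proof.
move=> s0; rewrite /order_stat_pdf; case: ifPn => // mx.
rewrite !mulr_ge0 ?invr_ge0 ?exprn_ge0 ?expR_ge0 ?mulr_ge0 ?(ltW s0)//.
by rewrite subr_ge0 -expR0 ler_expR oppr_le0 divr_ge0 ?(ltW s0)// subr_ge0 ltW.
Qed.

Lemma order_stat_pdf_scale (n a : nat) (m s x : R) : 0 < s ->
  order_stat_pdf n a m s (s * x) = s^-1 * order_stat_pdf n a (m / s) 1 x.
Proof.
move=> s0; have sN0 : s != 0 by rewrite gt_eqF.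
rewrite /order_stat_pdf ltr_pdivrMr// (mulrC x).
case: ifPn => _; last by rewrite mulr0.
have -> : (s * x - m) / s = (x - m / s) / 1 by field.
by rewrite invr1; ring.
Qed.

Lemma measurable_gamma_pdf (k : nat) (s : R) :
  measurable_fun setT (gamma_pdf k s).
Proof.
apply: measurable_fun_ifT => //; first exact: measurable_fun_ltr.
apply: measurable_funM => //; apply: measurable_funM => //.
apply: measurableT_comp => //; apply: measurableT_comp => //.
exact: measurable_funM.
Qed.

Lemma gamma_pdf_ge0 (k : nat) (s x : R) : 0 < s -> 0 <= gamma_pdf k s x.
Proof.
move=> s0; rewrite /gamma_pdf; case: ifPn => // x0.
by rewrite !mulr_ge0 ?invr_ge0 ?mulr_ge0 ?exprn_ge0 ?expR_ge0 ?(ltW s0)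
  ?(ltW x0).
Qed.

Lemma gamma_pdf_le0 (k : nat) (s x : R) : x <= 0 -> gamma_pdf k s x = 0.
Proof. by rewrite /gamma_pdf leNgt; case: ifP. Qed.

Lemma gamma_pdf_scale (k : nat) (s x : R) : (0 < k)%N -> 0 < s ->
  gamma_pdf k s (s * x) = s^-1 * gamma_pdf k 1 x.
Proof.
case: k => // k _ s0; have sN0 : s != 0 by rewrite gt_eqF.
rewrite /gamma_pdf pmulr_rgt0// subn1/=.
case: ifPn => _; last by rewrite mulr0.
have -> : s * x / s = x / 1 by field.
rewrite expr1n exprMn exprS; field.
by rewrite sN0 expf_neq0//= pnatr_eq0 -lt0n fact_gt0.
Qed.

(** Size biasing raises the shape by one. This accounts for the shape [k + 1] given the ratio, and
    for the further shift in the equation that defines [beta]. *)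
Lemma mulr_gamma_pdf (k : nat) (x : R) : (0 < k)%N ->
  x * gamma_pdf k 1 x = k%:R * gamma_pdf k.+1 1 x.
Proof.
case: k => // k _; rewrite /gamma_pdf !subn1/=.
case: ifPn => _; last by rewrite !mulr0.
rewrite !expr1n exprS factS natrM; field.
by rewrite nat1r !pnatr_eq0 -lt0n fact_gt0.
Qed.

Lemma mulr_gamma_pdf_ge0 (k : nat) (x : R) : 0 <= x * gamma_pdf k 1 x.
Proof.
have [x0|x0] := leP x 0; first by rewrite gamma_pdf_le0// mulr0.
by rewrite mulr_ge0 ?gamma_pdf_ge0 ?(ltW x0).
Qed.

End densities.

(** * Change of variables to the ratio and the rescaled denominator *)

Section ratio_scale.
Context {d : measure_display} {T : measurableType d} {R : realType}.
Variable P : probability T R.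
Local Notation mu := (@lebesgue_measure R).
Local Open Scope ereal_scope.

(** Substitute x = s z u and y = s u. The Jacobian contributes s^2 u; each density, brought to unit
    scale, contributes a factor 1/s, so only u remains. *)
Lemma ge0_expectation_ratio (X Y : {RV P >-> R}) (n a k : nat) (m s : R)
    (H : R * R -> \bar R) : (0 < k)%N -> (0 < s)%R ->
  has_pdf P X (order_stat_pdf n a m s) -> has_pdf P Y (gamma_pdf k s) ->
  (forall A B, measurable A -> measurable B ->
    P (X @^-1` A `&` Y @^-1` B) = P (X @^-1` A) * P (Y @^-1` B)) ->
  measurable_fun setT H -> (forall z, 0 <= H z) ->
  \int[P]_w H (X w / Y w, Y w / s)%R =
  \int[mu]_z \int[mu]_u
    (H (z, u) * (order_stat_pdf n a (m / s) 1 (z * u))%:E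
      * (u * gamma_pdf k 1 u)%:E).
Proof.
move=> k0 s0 Xf Yg indXY mH H0.
set f := order_stat_pdf n a m s in Xf *.
set fe := order_stat_pdf n a (m / s) 1.
have sN0 : s != 0%R by rewrite gt_eqF.
have mf : measurable_fun setT f by exact: measurable_order_stat_pdf.
have mfe : measurable_fun setT fe by exact: measurable_order_stat_pdf.
have f0 x : (0 <= f x)%R by exact: order_stat_pdf_ge0.
have fe0 x : (0 <= fe x)%R by exact: order_stat_pdf_ge0.
have mg : measurable_fun setT (gamma_pdf k s) by exact: measurable_gamma_pdf.
have g0 y : (0 <= gamma_pdf k s y)%R by exact: gamma_pdf_ge0.
pose F (p : R * R) := H (p.1 / p.2, p.2 / s)%R.
have mF : measurable_fun setT F.
  apply: measurableT_comp => //; apply: measurable_fun_pair.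
    by apply: measurable_funM => //; exact: measurable_funV.
  exact: measurable_funM.
have F0 p : 0 <= F p by exact: H0.
pose Q (p : R * R) := H p * (fe (p.1 * p.2))%:E
   * (p.2 * gamma_pdf k 1 p.2)%:E.
have mHfe : measurable_fun setT (fun p : R * R => H p * (fe (p.1 * p.2))%:E).
  apply: emeasurable_funM => //; apply/measurable_EFinP.
  by apply: measurableT_comp => //; exact: measurable_funM.
have mQ : measurable_fun setT Q.
  apply: emeasurable_funM => //; apply/measurable_EFinP.
  apply: measurable_funM => //.
  by apply: measurableT_comp => //; exact: measurable_gamma_pdf.
have Q0 p : 0 <= Q p.
  by rewrite !mule_ge0// ?lee_fin// mulr_gamma_pdf_ge0.
rewrite (ge0_integral_indep_pdf P X Y f (gamma_pdf k s) F)//.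
(* With [u] outermost, the inner variable can be dilated by [s * u] for fixed [u > 0]. *)
transitivity (\int[mu]_u \int[mu]_z Q (z, u)); last first.
  by rewrite -(fubini_tonelli (m1 := mu) (m2 := mu) Q).
pose G y := (\int[mu]_x (F (x, y) * (f x)%:E)) * (gamma_pdf k s y)%:E.
have mG : measurable_fun setT G.
  apply: emeasurable_funM; last exact/measurable_EFinP.
  pose Ff (p : R * R) := F p * (f p.1)%:E.
  have Ff0 p : 0 <= Ff p by rewrite mule_ge0// lee_fin.
  apply: (measurable_fun_fubini_tonelli_G (m1 := mu) Ff) => //.
  apply: emeasurable_funM => //; apply/measurable_EFinP.
  exact: measurableT_comp.
have G0 y : 0 <= G y.
  apply: mule_ge0; last by rewrite lee_fin.
  by apply: integral_ge0 => x _; rewrite mule_ge0// lee_fin.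
transitivity (s%:E * \int[mu]_u G (s * u)%R).
  by rewrite ge0_integral_scale// muleA -EFinM divff// mul1e.
rewrite -ge0_integralZl//; last 2 first.
- by apply: measurableT_comp => //; exact: mulrl_measurable.
- by rewrite lee_fin ltW.
apply: eq_integral => u _.
have [u0|u0] := leP u 0%R.
  rewrite /G gamma_pdf_le0 ?pmulr_rle0// !mule0.
  by apply/esym/integral0_eq => z _; rewrite /Q/= gamma_pdf_le0// mulr0 mule0.
have su0 : (0 < s * u)%R by rewrite mulr_gt0.
have uN0 : u != 0%R by rewrite gt_eqF.
pose K x := F (x, s * u)%R * (f x)%:E.
have mK : measurable_fun setT K.
  apply: emeasurable_funM; last exact/measurable_EFinP.
  exact: measurableT_comp.
have K0 x : 0 <= K x by rewrite mule_ge0// lee_fin.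
pose J := \int[mu]_z (H (z, u) * (fe (z * u))%:E).
have mJ : measurable_fun setT (fun z => H (z, u) * (fe (z * u)%R)%:E).
  by apply: (measurableT_comp mHfe (g := fun z => (z, u))).
have KE : \int[mu]_x K x = (s * u)%:E * (J * s^-1%:E).
  transitivity ((s * u)%:E * \int[mu]_z K (s * u * z)%R).
    by rewrite ge0_integral_scale// muleA -EFinM divff ?mul1e// gt_eqF.
  congr (_ * _); rewrite -ge0_integralZr//; last 2 first.
  - by move=> z _; rewrite mule_ge0// lee_fin.
  - by rewrite lee_fin invr_ge0 ltW.
  apply: eq_integral => z _; rewrite /K /F/=.
  have -> : (s * u * z / (s * u) = z)%R by field; rewrite sN0 uN0.
  have -> : (s * u / s = u)%R by field.
  have -> : (s * u * z = s * (z * u))%R by ring.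
  by rewrite /f order_stat_pdf_scale// (mulrC s^-1%R) EFinM muleA.
rewrite /G -/(K _) KE gamma_pdf_scale//.
transitivity (J * (u * gamma_pdf k 1 u)%:E); last first.
  rewrite -ge0_integralZr//; first by move=> z _; rewrite mule_ge0// lee_fin.
  by rewrite lee_fin mulr_gamma_pdf_ge0.
rewrite (muleC (s * u)%:E) -!muleA (muleC s%:E) -!muleA -!EFinM.
by congr (_ * _%:E); field.
Qed.

End ratio_scale.

(** * Bowl-shaped losses *)

Section bowl.
Context {R : realType}.

(** The difference quotient is the product [(f y - f x) * (y - x)] divided by a square, so one sign
    condition covers increments of both signs. *)
Lemma near_monotone_derive1_ge0 (f : R -> R) (x : R) : derivable f x 1 ->
  (\forall y \near x, 0 <= (f y - f x) * (y - x)) -> 0 <= derive1 f x.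
Proof.
move=> dfx [e /= e0 fe]; apply: limr_ge.
  under eq_fun; first (move=> h; rewrite -{2}(scaler1 h); over).
  exact: dfx.
near=> h.
have h0 : h != 0 by near: h; exact: nbhs_dnbhs_neq.
have /fe : ball x e (h + x).
  rewrite /ball/= opprD addrCA subrr addr0 normrN.
  by near: h; exact: dnbhs0_lt.
rewrite addrK => fh.
have -> : h^-1 *: (f (h + x) - f x) = (f (h + x) - f x) * h * (h^-1) ^+ 2.
  by rewrite /GRing.scale/=; field.
by rewrite mulr_ge0// sqr_ge0.
Unshelve. all: end_near. Qed.

Context {L : R -> R}.
Hypothesis Ldiff : forall t, 0 < t -> derivable L t 1.
Hypothesis Lbowl : bowl_shaped L.

Lemma bowl_ge0 t : 0 < t -> 0 <= L t.
Proof.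
have [L1 Ldn Lup] := Lbowl => t0; rewrite -L1.
by have [t1|/ltW t1] := leP t 1; [exact: Ldn|exact: Lup].
Qed.

Lemma bowl_derive1_le0 t : 0 < t -> t < 1 -> derive1 L t <= 0.
Proof.
have [_ Ldn _] := Lbowl => t0 t1.
have dLt := Ldiff t t0.
rewrite -oppr_ge0 derive1E -deriveN// -derive1E.
apply: near_monotone_derive1_ge0; first exact: derivableN.
near=> y.
have y0 : 0 < y by near: y; exact: lt_nbhsr.
have y1 : y < 1 by near: y; exact: lt_nbhsl.
rewrite /= opprK; have [yt|/ltW ty] := leP y t.
  rewrite mulr_le0// ?subr_le0// addrC subr_le0.
  exact/Ldn/ltW.
rewrite mulr_ge0 ?subr_ge0// addrC subr_ge0.
exact/Ldn/ltW.
Unshelve. all: end_near. Qed.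

Lemma bowl_derive1_ge0 t : 1 < t -> 0 <= derive1 L t.
Proof.
have [_ _ Lup] := Lbowl => t1.
apply: near_monotone_derive1_ge0; first exact/Ldiff/(lt_trans ltr01).
near=> y.
have y1 : 1 < y by near: y; exact: lt_nbhsr.
have [yt|/ltW ty] := leP y t.
  by rewrite mulr_le0// subr_le0//; exact/Lup/yt/ltW.
by rewrite mulr_ge0 ?subr_ge0//; exact/Lup/ty/ltW.
Unshelve. all: end_near. Qed.

(* For [b <= c] the difference [L (c * u) - L (b * u)] changes sign at most
   once, from negative to positive, so that a nondecreasing weight can be
   replaced by a constant. *)
Lemma bowl_single_crossing (b c hmin hmax : R) (h : R -> R) : 0 < b -> b <= c ->
  (forall u v, 0 < u -> u <= v -> h u <= h v) ->
  (forall u, 0 < u -> hmin <= h u <= hmax) ->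
  exists2 h0, hmin <= h0 & forall u, 0 < u ->
    h0 * (L (c * u) - L (b * u)) <= h u * (L (c * u) - L (b * u)).
Proof.
have [_ Ldn Lup] := Lbowl => b0 bc hnd hbnd.
have c0 : 0 < c by exact: lt_le_trans bc.
(* A positive difference at [u] forces [1 <= c * u], a negative one at [v] forces [b * v <= 1]. If
   [u < v], monotonicity of [L] on either side of 1 then contradicts the two signs. *)
have crossing u v : 0 < u -> 0 < v -> 0 < L (c * u) - L (b * u) ->
    L (c * v) - L (b * v) < 0 -> v <= u.
  rewrite subr_gt0 subr_lt0 => u0 v0 Du Dv; rewrite leNgt; apply/negP => uv.
  have bu0 : 0 < b * u by rewrite mulr_gt0.
  have cu1 : 1 <= c * u.
    rewrite leNgt; apply/negP => cu1.
    have : L (c * u) <= L (b * u) by apply: Ldn; rewrite ?ler_pM2r// ltW.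
    by rewrite leNgt Du.
  have bv1 : b * v <= 1.
    rewrite leNgt; apply/negP => bv1.
    have : L (b * v) <= L (c * v) by apply: Lup; rewrite ?ler_pM2r// ltW.
    by rewrite leNgt Dv.
  have : L (c * u) <= L (c * v) by apply: Lup => //; rewrite ler_pM2l// ltW.
  have : L (b * v) <= L (b * u) by apply: Ldn => //; rewrite ler_pM2l// ltW.
  by move: Du Dv; lra.
(* [h0] will be the supremum of [h] where the difference is negative; where it is positive, [h] is
   at least as large. Adding [hmin] keeps the set nonempty and gives [hmin <= h0]. *)
pose S := [set hmin] `|`
  [set h u | u in [set u | 0 < u /\ L (c * u) - L (b * u) < 0]].
have S0 : S !=set0 by exists hmin; left.
have hS : has_sup S.
  split=> //; exists (Num.max hmin hmax) => _ [->|[u [u0 _] <-]].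
    by rewrite le_max lexx.
  by rewrite le_max; have /andP[_ ->] := hbnd u u0; rewrite orbT.
exists (sup S); first by apply: sup_upper_bound => //; left.
move=> u u0; have [D0|D0] := leP 0 (L (c * u) - L (b * u)).
  have [->|DN0] := eqVneq (L (c * u) - L (b * u)) 0; first by rewrite !mulr0.
  have Dpos : 0 < L (c * u) - L (b * u) by rewrite lt_neqAle eq_sym DN0.
  rewrite ler_pM2r//; apply: ge_sup => // _ [->|[v [v0 Dv] <-]].
    by have /andP[] := hbnd u u0.
  exact/hnd/crossing/Dv.
by rewrite ler_nM2r//; apply: sup_upper_bound => //; right; exists u.
Qed.

End bowl.

(** * Gamma means of a bowl-shaped loss *)

Section gamma_means.
Context {R : realType}.
Local Notation mu := (@lebesgue_measure R).

(** Dilation amounts to an exponential tilt. The tilt is monotone, which serves the comparison of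
    derivatives, and it absorbs the exponential factor of the order statistic density. *)
Lemma gamma_pdf_dilate (k : nat) (q s : R) : 0 < q ->
  gamma_pdf k 1 (q * s) =
    q ^+ (k - 1) * expR ((1 - q) * s) * gamma_pdf k 1 s.
Proof.
move=> q0; rewrite /gamma_pdf pmulr_rgt0//.
case: ifPn => _; last by rewrite mulr0.
have -> : - (q * s / 1) = (1 - q) * s + - (s / 1) by field.
by rewrite expRD exprMn; ring.
Qed.

Context {L : R -> R} {k0 : nat}.
Hypothesis Ldiff : forall t, 0 < t -> derivable L t 1.
Hypothesis Lbowl : bowl_shaped L.
Hypothesis Lreg : gamma_regular k0 L.

Local Notation G k c := (gamma_mean k (fun v => L (c * v))).
Local Notation dG k c := (gamma_mean k (fun v => derive1 L (c * v) * v)).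

(** By size biasing, the critical points of the mean loss for shape [k] are the roots of E L'(W c) =
    0 with W of shape [k + 1], which is the form of the equation for [beta]. *)
Lemma gamma_mean_derive_shift (k : nat) (c : R) :
  (0 < k)%N -> (k0 <= k)%N -> 0 < c ->
  dG k c = k%:R * gamma_mean k.+1 (fun w => derive1 L (w * c)).
Proof.
move=> k_gt0 k0k c0; have [_ int _] := Lreg k c k0k c0.
have kN0 : k%:R != 0 :> R by rewrite pnatr_eq0 -lt0n.
rewrite /gamma_mean -RintegralZl//.
  apply: eq_Rintegral => v _.
  by rewrite -mulrA mulr_gamma_pdf// (mulrC v c) mulrCA.
move: int => /(integrableZl measurableT k%:R^-1).
apply: eq_integrable => // v _ /=.
rewrite -EFinM -(mulrA _ v) mulr_gamma_pdf// (mulrC v c).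
by congr EFin; field.
Qed.

(* After the dilation [v = (b / c) * s] the integrand of [dG k c] is that of
   [dG k b] times an increasing exponential, which is compared with its value
   at the point [s = 1 / b] where [L' (b * s)] changes sign. *)
Lemma gamma_mean_derive_ge0 (k : nat) (b c : R) :
  (0 < k)%N -> (k0 <= k)%N -> 0 < b -> b <= c -> dG k b = 0 -> 0 <= dG k c.
Proof.
move=> k_gt0 k0k b0 bc dGb0.
have c0 : 0 < c by exact: lt_le_trans bc.
have [_ intb _] := Lreg k b k0k b0.
have [_ intc _] := Lreg k c k0k c0.
pose phi c v := derive1 L (c * v) * v * gamma_pdf k 1 v.
pose q := b / c.
have q0 : 0 < q by rewrite divr_gt0.
have q1 : q <= 1 by rewrite ler_pdivrMr// mul1r.
have phiE s : phi c (q * s) = q ^+ k * expR ((1 - q) * s) * phi b s.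
  rewrite /phi gamma_pdf_dilate//.
  have -> : c * (q * s) = b * s by rewrite /q; field; rewrite gt_eqF.
  have -> : q ^+ k = q * q ^+ (k - 1) by rewrite -exprS subn1 prednK.
  by ring.
pose e0 := q ^+ k * expR ((1 - q) * b^-1).
have phi_ge s : e0 * phi b s <= phi c (q * s).
  rewrite phiE /phi; have [s0|s0] := leP s 0.
    by rewrite gamma_pdf_le0// !mulr0.
  set D := derive1 L (b * s).
  rewrite -(mulrA D) !(mulrA _ D) ler_wpM2r ?mulr_gamma_pdf_ge0//.
  have qk0 : 0 <= q ^+ k by rewrite exprn_ge0// ltW.
  (* On each side of [1 / b], the derivative of [L] and the excess of the exponential factor over
     its value at [1 / b] have the same weak sign. *)
  have [bs|bs|bs] := ltgtP (b * s) 1.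
  - rewrite ler_wnM2r//; first by apply: bowl_derive1_le0; rewrite // mulr_gt0.
    rewrite ler_wpM2l// ler_expR ler_wpM2l ?subr_ge0//.
    by rewrite -(ler_pM2l b0) divff ?gt_eqF// ltW.
  - rewrite ler_wpM2r//; first exact: bowl_derive1_ge0.
    rewrite ler_wpM2l// ler_expR ler_wpM2l ?subr_ge0//.
    by rewrite -(ler_pM2l b0) divff ?gt_eqF// ltW.
  - by rewrite /e0 -[b^-1]mulr1 -bs mulKf ?gt_eqF.
have intcq : mu.-integrable setT (EFin \o (fun s => phi c (q * s))).
  exact: (integrable_scale q (EFin \o phi c)).
have dGcE : dG k c = q * \int[mu]_s phi c (q * s).
  rewrite [in RHS]/Rintegral (integral_scale q (EFin \o phi c))//.
  rewrite fineM//; last exact: integrable_fin_num.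
  by rewrite /= mulrA divff ?gt_eqF// mul1r.
rewrite dGcE mulr_ge0 ?(ltW q0)//.
apply: (@le_trans _ _ (\int[mu]_s (e0 * phi b s))).
  by rewrite RintegralZl// -[Rintegral _ _ _]/(dG k b) dGb0 mulr0.
apply: le_Rintegral => //.
exact: (integrableZl measurableT e0 intb).
Qed.

(** [L] is only weakly monotone, so strictness comes from uniqueness of the root: a vanishing
    derivative at some [z > b] would give a second root. *)
Lemma gamma_mean_increasing (k : nat) (b : R) : (0 < k)%N -> (k0 <= k)%N ->
  unique_pos_root (fun c => gamma_mean k.+1 (fun w => derive1 L (w * c))) b ->
  {in `[b, +oo[ &, {homo (fun c => G k c) : x y / x < y}}.
Proof.
move=> k_gt0 k0k [b0 rootb uniqb] x y; rewrite !in_itv/= !andbT => bx by_ xy.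
have dGb0 : dG k b = 0 by rewrite gamma_mean_derive_shift// rootb mulr0.
have derG c : b <= c -> is_derive c 1 (fun c' => G k c') (dG k c).
  by move=> bc; have [] := Lreg k c k0k (lt_le_trans b0 bc).
have [] : x \in `[x, y] /\ y \in `[x, y].
  by rewrite !in_itv/= !lexx ltW.
move=> xI yI.
apply: (gtr0_derive1_lt_cc (f := fun c => G k c) (a := x) (b := y)) => //.
- move=> z; rewrite in_itv/= => /andP[xz _].
  by have := derG z (le_trans bx (ltW xz)) => -[].
- move=> z; rewrite in_itv/= => /andP[xz _].
  have bz : b < z by exact: le_lt_trans xz.
  have dz := derG z (ltW bz).
  rewrite derive1E derive_val lt_neqAle (gamma_mean_derive_ge0 k b z)// ?ltW//.
  rewrite andbT eq_sym; apply/negP => /eqP dGz0.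
  have z0 : 0 < z by exact: lt_trans bz.
  have rootz : gamma_mean k.+1 (fun w => derive1 L (w * z)) = 0.
    have shift := gamma_mean_derive_shift k z k_gt0 k0k z0.
    apply: (mulfI (_ : k%:R != 0)); first by rewrite pnatr_eq0 -lt0n.
    by rewrite mulr0 -shift -dGz0.
  by rewrite (uniqb z z0 rootz) ltxx in bz.
- apply: derivable_within_continuous => z; rewrite in_itv/= => /andP[xz _].
  by have := derG z (le_trans bx xz) => -[].
Qed.

Local Open Scope ereal_scope.

(** Integrating the single-crossing inequality against the Gamma density gives the bound with [h0],
    which is at least [hmin]. The explicit gap will yield strict domination. *)
Lemma weighted_gamma_mean_le (k : nat) (b c hmin hmax : R) (h : R -> R) :
  (k0 <= k)%N -> (0 < b)%R -> (b <= c)%R -> (G k b <= G k c)%R ->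
  (0 <= hmin)%R -> measurable_fun setT h ->
  (forall u v, 0 < u -> u <= v -> h u <= h v)%R ->
  (forall u, 0 < u -> hmin <= h u <= hmax)%R ->
  \int[mu]_u (L (b * u) * gamma_pdf k 1 u * h u)%:E
    + (hmin * (G k c - G k b))%:E
  <= \int[mu]_u (L (c * u) * gamma_pdf k 1 u * h u)%:E.
Proof.
move=> k0k b0 bc Gbc hmin0 mh hnd hbnd.
have c0 : (0 < c)%R by exact: lt_le_trans bc.
have [h0 hh0 cross] :=
  bowl_single_crossing Lbowl b c hmin hmax h b0 bc hnd hbnd.
have [intb _ _] := Lreg k b k0k b0.
have [intc _ _] := Lreg k c k0k c0.
pose B x u := (L (x * u) * gamma_pdf k 1 u)%R.
have B0 x u : (0 < x)%R -> (0 <= B x u)%R.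
  move=> x0; rewrite /B; have [u0|u0] := leP u 0%R.
    by rewrite gamma_pdf_le0// mulr0.
  by rewrite mulr_ge0 ?gamma_pdf_ge0// bowl_ge0// mulr_gt0.
have Bh0 x u : (0 < x)%R -> (0 <= B x u * h u)%R.
  move=> x0; have [u0|u0] := leP u 0%R.
    by rewrite /B gamma_pdf_le0// mulr0 mul0r.
  rewrite mulr_ge0 ?B0//; have /andP[+ _] := hbnd u u0.
  exact: le_trans.
have h00 : (0 <= h0)%R by exact: le_trans hh0.
have mB x : (0 < x)%R -> measurable_fun setT (B x).
  move=> x0; have [intx _ _] := Lreg k x k0k x0.
  by apply/measurable_EFinP; exact: (measurable_int mu intx).
have mBh x : (0 < x)%R -> measurable_fun setT (fun u => B x u * h u)%R.
  by move=> x0; apply: measurable_funM => //; exact: mB.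
have GE x : (0 < x)%R -> \int[mu]_u (h0 * B x u)%:E = (h0 * G k x)%:E.
  move=> x0; have [intx _ _] := Lreg k x k0k x0.
  under eq_integral do rewrite EFinM.
  rewrite integralZl//= EFinM; congr (_ * _).
  by rewrite /gamma_mean /Rintegral fineK//; exact: integrable_fin_num.
(* Stated with sums of nonnegative terms only, so that no infinite integral has to be subtracted. *)
have main : \int[mu]_u (B b u * h u)%:E + (h0 * G k c)%:E <=
            \int[mu]_u (B c u * h u)%:E + (h0 * G k b)%:E.
  have splitD x y : (0 < x)%R -> (0 < y)%R ->
      \int[mu]_u (B x u * h u)%:E + (h0 * G k y)%:E =
      \int[mu]_u (B x u * h u + h0 * B y u)%:E.
    move=> x0 y0; rewrite -GE//; under [RHS]eq_integral do rewrite EFinD.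
    rewrite ge0_integralD//.
    - by move=> u _; rewrite lee_fin Bh0.
    - by apply/measurable_EFinP; exact: mBh.
    - by move=> u _; rewrite lee_fin mulr_ge0// B0.
    - by apply/measurable_EFinP/measurable_funM => //; exact: mB.
  rewrite !splitD//.
  apply: ge0_le_integral => //.
  - by move=> u _; rewrite lee_fin addr_ge0 ?Bh0// mulr_ge0 ?B0.
  - apply/measurable_EFinP/measurable_funD; first exact: mBh.
    by apply: measurable_funM => //; exact: mB.
  - apply/measurable_EFinP/measurable_funD; first exact: mBh.
    by apply: measurable_funM => //; exact: mB.
  move=> u _; rewrite lee_fin /B; have [u0|u0] := leP u 0%R.
    by rewrite gamma_pdf_le0// !(mulr0, mul0r).
  have := ler_wpM2r (gamma_pdf_ge0 k 1 u ltr01) (cross u u0); lra.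
move: main; rewrite -/(B _ _).
case: (\int[mu]_u (B c u * h u)%:E) => [r| |]; last 2 first.
- by move=> _; rewrite leey.
- by rewrite addNye leeNy_eq adde_eq_ninfty/= orbF => /eqP ->; rewrite addNye.
case: (\int[mu]_u (B b u * h u)%:E) => [r'| |]; last 2 first.
- by rewrite addye// -EFinD leye_eq.
- by move=> _; rewrite addNye leNye.
rewrite -!EFinD !lee_fin => H.
have : (hmin * (G k c - G k b) <= h0 * (G k c - G k b))%R.
  by rewrite ler_wpM2r// subr_ge0.
lra.
Qed.

End gamma_means.

(** * Conditional risks *)

Section risk_comparison.
Context {R : realType}.
Local Notation mu := (@lebesgue_measure R).

(* [L] is arbitrary, possibly non-measurable, on ]-oo, 0]. *)
Definition pos_part_loss (L : R -> R) (t : R) : R := if 0 < t then L t else 0.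

Lemma measurable_pos_part_loss (L : R -> R) :
  (forall t, 0 < t -> derivable L t 1) -> measurable_fun setT (pos_part_loss L).
Proof.
move=> dL; apply: measurable_fun_if => //; first exact: measurable_fun_ltr.
rewrite setTI (_ : _ @^-1` _ = `]0, +oo[%classic); last first.
  by apply/seteqP; split => t /=; rewrite in_itv/= andbT.
apply: open_continuous_measurable_fun; first exact: interval_open.
move=> t; rewrite inE/= in_itv/= andbT => t0.
exact/differentiable_continuous/derivable1_diffP/dL.
Qed.

Lemma pos_part_loss_ge0 (L : R -> R) (t : R) : bowl_shaped L ->
  0 <= pos_part_loss L t.
Proof.
by move=> bL; rewrite /pos_part_loss; case: ifPn => // /(bowl_ge0 bL).
Qed.

(** The nondecreasing factor left in the unit-scale order statistic density once its constant and
    the exponential in [y] are split off. *)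
Definition order_stat_weight (a : nat) (eta y : R) : R :=
  if eta < y then (1 - expR (- (y - eta))) ^+ (a - 1) else 0.

Lemma order_stat_pdfE (n a : nat) (eta y : R) :
  order_stat_pdf n a eta 1 y =
    (n`!%:R / ((a - 1)`!%:R * (n - a)`!%:R) * expR ((n - a + 1)%:R * eta))
    * expR (- ((n - a + 1)%:R * y)) * order_stat_weight a eta y.
Proof.
rewrite /order_stat_pdf /order_stat_weight.
case: ifPn => _; last by rewrite mulr0.
rewrite !divr1 -[expR _ ^+ (n - a + 1)]expRM_natl.
have -> : (n - a + 1)%:R * - (y - eta) =
    (n - a + 1)%:R * eta + - ((n - a + 1)%:R * y) by ring.
by rewrite expRD; ring.
Qed.

Lemma measurable_order_stat_weight (a : nat) (eta : R) :
  measurable_fun setT (order_stat_weight a eta).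
Proof.
apply: measurable_fun_ifT => //; first exact: measurable_fun_ltr.
apply: measurable_funX; apply: measurable_funB => //.
apply: measurableT_comp => //; apply: measurableT_comp => //.
exact: measurable_funB.
Qed.

Lemma order_stat_weight_ndecr (a : nat) (eta x y : R) : x <= y ->
  order_stat_weight a eta x <= order_stat_weight a eta y.
Proof.
have ge0 t : eta < t -> 0 <= 1 - expR (- (t - eta)).
  by move=> et; rewrite subr_ge0 -expR0 ler_expR oppr_le0 subr_ge0 ltW.
move=> xy; rewrite /order_stat_weight; case: ifPn => ex.
  have ey : eta < y by exact: lt_le_trans xy.
  rewrite ey lerXn2r ?nnegrE ?ge0// lerD2l lerN2 ler_expR lerN2.
  by rewrite lerD2r.
by case: ifPn => // ey; rewrite exprn_ge0// ge0.
Qed.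

Lemma order_stat_weight_itv (a : nat) (eta y : R) :
  0 <= order_stat_weight a eta y <= 1.
Proof.
rewrite /order_stat_weight; case: ifPn => [ey|_]; last by rewrite lexx ler01.
have e1 : expR (- (y - eta)) <= 1.
  by rewrite -expR0 ler_expR oppr_le0 subr_ge0 ltW.
rewrite exprn_ge0 ?subr_ge0//= exprn_ile1 ?subr_ge0//.
Qed.

Variables (L : R -> R) (k : nat).

(* The conditional risk of [x * V2] given [X2 / V2 = z], times the density of
   [X2 / V2] at [z]; here [eta = mu2 / sigma2]. *)
Definition cond_risk (n a : nat) (eta x z : R) : \bar R :=
  (\int[mu]_u ((pos_part_loss L (x * u))%:E
    * (order_stat_pdf n a eta 1 (z * u))%:E * (u * gamma_pdf k 1 u)%:E))%E.

(** The order statistic constant, times [k] from size biasing, times q^-k from the dilated Gamma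
    density and q^-1 from the substitution. *)
Definition cond_risk_factor (n a : nat) (eta q : R) : R :=
  n`!%:R / ((a - 1)`!%:R * (n - a)`!%:R) * expR ((n - a + 1)%:R * eta)
    * k%:R * q^-1 ^+ k.+1.

Hypothesis k_gt0 : (0 < k)%N.

Lemma cond_risk_factor_gt0 (n a : nat) (eta q : R) : 0 < q ->
  0 < cond_risk_factor n a eta q.
Proof.
move=> q0; rewrite /cond_risk_factor mulr_gt0 ?exprn_gt0 ?invr_gt0//.
rewrite mulr_gt0 ?ltr0n// mulr_gt0 ?expR_gt0// divr_gt0 ?mulr_gt0//;
  by rewrite ltr0n fact_gt0.
Qed.

Lemma cond_risk_factor_nincr (n a : nat) (eta : R) :
  {in Num.pos &, {homo cond_risk_factor n a eta : x y /~ x <= y}}.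
Proof.
move=> x y; rewrite !posrE => x0 y0 yx; rewrite /cond_risk_factor.
rewrite ler_wpM2l ?mulr_ge0 ?expR_ge0 ?invr_ge0 ?mulr_ge0//.
by rewrite lerXn2r ?nnegrE ?invr_ge0 ?(ltW x0) ?(ltW y0)// lef_pV2.
Qed.

Hypothesis Ldiff : forall t, 0 < t -> derivable L t 1.
Hypothesis Lbowl : bowl_shaped L.
Hypothesis Lreg : gamma_regular k L.

(** Substitute s = q u. With m = n - a + 1, the factor exp(- m z u) of the order statistic combines
    with exp(- u) into exp(- s), so a Gamma density of shape [k + 1] and the weight remain. *)
Lemma cond_risk_dilate (n a : nat) (eta x z : R) (q := 1 + (n - a + 1)%:R * z) :
  0 < q -> 0 < x ->
  cond_risk n a eta (x * q) z =
  ((cond_risk_factor n a eta q)%:E * \int[mu]_s (L (x * s) * gamma_pdf k.+1 1 s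
    * order_stat_weight a eta (z / q * s))%:E)%E.
Proof.
move=> q0 x0.
set C := n`!%:R / ((a - 1)`!%:R * (n - a)`!%:R) * expR ((n - a + 1)%:R * eta).
have qN0 : q != 0 by rewrite gt_eqF.
have C0 : 0 <= C by rewrite !mulr_ge0 ?invr_ge0 ?mulr_ge0 ?expR_ge0.
have qi0 : 0 < q^-1 by rewrite invr_gt0.
pose W s := pos_part_loss L (x * s) * gamma_pdf k.+1 1 s
    * order_stat_weight a eta (z / q * s).
pose F u := pos_part_loss L (x * q * u) * order_stat_pdf n a eta 1 (z * u)
  * (u * gamma_pdf k 1 u).
have mW : measurable_fun setT W.
  apply: measurable_funM; last first.
    apply: (measurableT_comp (measurable_order_stat_weight a eta)).
    exact: mulrl_measurable.
  apply: measurable_funM; last exact: measurable_gamma_pdf.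
  apply: (measurableT_comp (measurable_pos_part_loss L Ldiff)).
  exact: mulrl_measurable.
have W0 s : 0 <= W s.
  rewrite !mulr_ge0 ?gamma_pdf_ge0 ?pos_part_loss_ge0//.
  by have /andP[] := order_stat_weight_itv a eta (z / q * s).
have mF : measurable_fun setT F.
  apply: measurable_funM; last first.
    by apply: measurable_funM => //; exact: measurable_gamma_pdf.
  apply: measurable_funM; last first.
    apply: (measurableT_comp (measurable_order_stat_pdf n a eta 1)).
    exact: mulrl_measurable.
  apply: (measurableT_comp (measurable_pos_part_loss L Ldiff)).
  exact: mulrl_measurable.
have F0 u : 0 <= F u.
  rewrite mulr_ge0 ?mulr_gamma_pdf_ge0// mulr_ge0 ?order_stat_pdf_ge0//.
  exact: pos_part_loss_ge0.
have FW s : F (q^-1 * s) = C * k%:R * q^-1 ^+ k * W s.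
  rewrite /F /W mulr_gamma_pdf// gamma_pdf_dilate// order_stat_pdfE -/C subn1/=.
  have -> : x * q * (q^-1 * s) = x * s by field.
  have -> : z * (q^-1 * s) = z / q * s by field.
  (* This exponent cancels the tilt produced by the dilated Gamma density. *)
  have -> : (n - a + 1)%:R * (z / q * s) = (1 - q^-1) * s.
    have Mz : (n - a + 1)%:R * z = q - 1 by rewrite /q addrC addKr.
    by rewrite !mulrA Mz mulrBl divff// mul1r.
  by rewrite expRN; field; rewrite gt_eqF ?expR_gt0.
rewrite /cond_risk.
transitivity ((q^-1)%:E * \int[mu]_s (F (q^-1 * s))%:E)%E.
  rewrite (ge0_integral_scale q^-1 (EFin \o F))//; last exact/measurable_EFinP.
  rewrite invrK muleA -EFinM mulVf// mul1e.
  by apply: eq_integral => u _; rewrite /F/= !EFinM.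
under eq_integral do rewrite FW EFinM.
rewrite ge0_integralZl//; last 3 first.
- exact/measurable_EFinP.
- by move=> s _; rewrite lee_fin.
- by rewrite lee_fin !mulr_ge0 ?exprn_ge0 ?(ltW qi0).
rewrite muleA -EFinM; congr (_ * _)%E.
  by congr EFin; rewrite /cond_risk_factor -/C exprS; ring.
apply: eq_integral => s _; congr EFin; rewrite /W /pos_part_loss pmulr_rgt0//.
by case: ltP => // s0; rewrite gamma_pdf_le0// !(mulr0, mul0r).
Qed.

(** After a common dilation by [q] the multipliers [b] and [c / q] are compared. Taking [hmin = 0]
    gives the weak inequality for every parameter, a positive [hmin] the strict one for some
    parameter. *)
Lemma cond_risk_le (n a : nat) (eta b c z hmin : R)
    (q := 1 + (n - a + 1)%:R * z) :
  0 < z -> 0 < b -> b * q <= c -> 0 <= hmin ->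
  gamma_mean k.+1 (fun v => L (b * v)) <=
    gamma_mean k.+1 (fun v => L (c / q * v)) ->
  (forall y, 0 < y -> hmin <= order_stat_weight a eta y) ->
  (cond_risk n a eta (b * q) z
    + (cond_risk_factor n a eta q * (hmin *
      (gamma_mean k.+1 (fun v => L (c / q * v))
        - gamma_mean k.+1 (fun v => L (b * v)))))%:E
  <= cond_risk n a eta c z)%E.
Proof.
move=> z0 b0 bqc hmin0 Gbc hwt.
have q0 : 0 < q by rewrite addr_gt0// mulr_gt0// ltr0n addn1.
have zq0 : 0 < z / q by rewrite divr_gt0.
have bcq : b <= c / q by rewrite ler_pdivlMr.
have -> : c = c / q * q by rewrite divfK// gt_eqF.
rewrite !cond_risk_dilate//; last exact: lt_le_trans bcq.
rewrite (divfK (lt0r_neq0 q0)).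
have cst0 : 0 <= cond_risk_factor n a eta q.
  exact/ltW/cond_risk_factor_gt0.
rewrite [X in (_ + X <= _)%E]EFinM -ge0_muleDr; last 2 first.
- apply: integral_ge0 => s _; rewrite lee_fin.
  have [s0|s0] := leP s 0; first by rewrite gamma_pdf_le0// !(mulr0, mul0r).
  rewrite !mulr_ge0 ?gamma_pdf_ge0 ?(bowl_ge0 Lbowl) ?mulr_gt0//.
  by have /andP[] := order_stat_weight_itv a eta (z / q * s).
- by rewrite lee_fin mulr_ge0// subr_ge0.
apply: lee_wpmul2l; first by rewrite lee_fin.
apply: (weighted_gamma_mean_le Lbowl Lreg k.+1 b (c / q) hmin 1
  (fun s => order_stat_weight a eta (z / q * s))) => //.
- apply: (measurableT_comp (measurable_order_stat_weight a eta)).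
  exact: mulrl_measurable.
- by move=> u v _ uv; apply: order_stat_weight_ndecr; rewrite ler_pM2l.
- move=> u u0; have zqu0 : 0 < z / q * u by rewrite mulr_gt0.
  rewrite hwt//=.
  by have /andP[] := order_stat_weight_itv a eta (z / q * u).
Qed.

End risk_comparison.

(** * Risks of a Gamma variable multiplied by a function of the ratio *)

Section ratio_estimators.
Context {d : measure_display} {T : measurableType d} {R : realType}.
Local Notation mu := (@lebesgue_measure R).
Local Open Scope ereal_scope.

Lemma gamma_pdf_le0_null (P : probability T R) (Y : {RV P >-> R}) (k : nat)
    (s : R) :
  has_pdf P Y (gamma_pdf k s) -> P (Y @^-1` `]-oo, 0%R]) = 0.
Proof.
move=> ->//; apply: integral0_eq => y /=; rewrite in_itv/= => y0.
by rewrite gamma_pdf_le0.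
Qed.

(** [Y] is positive almost surely, so the arbitrary values of [L] on nonpositive arguments do not
    affect the risk. *)
Lemma integral_loss_pos_part (P : probability T R) (Y : {RV P >-> R})
    (L : R -> R) (k : nat) (s : R) (phi : T -> R) :
  has_pdf P Y (gamma_pdf k s) -> (0 < s)%R -> (forall w, 0 < phi w)%R ->
  \int[P]_w (L (phi w * Y w / s))%:E =
  \int[P]_w (pos_part_loss L (phi w * (Y w / s)))%:E.
Proof.
move=> Yg s0 phi0; apply: (integral_off_null P (Y @^-1` `]-oo, 0%R])).
- rewrite -[X in measurable X]setTI.
  by apply: (measurable_funPT Y) => //; exact: measurable_itv.
- exact: gamma_pdf_le0_null Yg.
- move=> w /=; rewrite in_itv/= => /negP; rewrite -ltNge => Yw0.
  by rewrite /pos_part_loss mulr_gt0 ?divr_gt0// mulrA.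
Qed.

Lemma measurable_cond_risk_integrand (L : R -> R) (k n a : nat) (eta : R)
    (Phi : R -> R) :
  (forall t, (0 < t)%R -> derivable L t 1) -> measurable_fun setT Phi ->
  measurable_fun setT (fun p : R * R =>
    (pos_part_loss L (Phi p.1 * p.2))%:E
      * (order_stat_pdf n a eta 1 (p.1 * p.2))%:E
      * (p.2 * gamma_pdf k 1 p.2)%:E).
Proof.
move=> dL mPhi; apply: emeasurable_funM; last first.
  apply/measurable_EFinP; apply: measurable_funM => //.
  apply: (measurableT_comp (measurable_gamma_pdf k 1)) => //.
apply: emeasurable_funM; apply/measurable_EFinP.
  apply: (measurableT_comp (measurable_pos_part_loss L dL)).
  by apply: measurable_funM => //; exact: measurableT_comp.
apply: (measurableT_comp (measurable_order_stat_pdf n a eta 1)).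
exact: measurable_funM.
Qed.

Lemma measurable_cond_risk (L : R -> R) (k n a : nat) (eta : R)
    (Phi : R -> R) : bowl_shaped L ->
  (forall t, (0 < t)%R -> derivable L t 1) -> measurable_fun setT Phi ->
  measurable_fun setT (fun z => cond_risk L k n a eta (Phi z) z).
Proof.
move=> bL dL mPhi.
apply: (measurable_fun_fubini_tonelli_F (m2 := mu) _
  (measurable_cond_risk_integrand L k n a eta Phi dL mPhi)).
move=> p; rewrite !mule_ge0// lee_fin ?mulr_gamma_pdf_ge0//.
  exact: pos_part_loss_ge0.
exact: order_stat_pdf_ge0.
Qed.

Lemma cond_risk_ge0 (L : R -> R) (k n a : nat) (eta x z : R) :
  bowl_shaped L -> 0 <= cond_risk L k n a eta x z.
Proof.
move=> bL; apply: integral_ge0 => u _.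
rewrite !mule_ge0// lee_fin ?mulr_gamma_pdf_ge0//.
  exact: pos_part_loss_ge0.
exact: order_stat_pdf_ge0.
Qed.

(** [Phi (X / Y) * Y / s] is a function of the ratio and of [Y / s] alone, so the change of
    variables applies and only [m / s] enters the risk. *)
Lemma integral_loss_ratio (P : probability T R) (X Y : {RV P >-> R})
    (n a k : nat) (m s : R) (L Phi : R -> R) : (0 < k)%N -> (0 < s)%R ->
  has_pdf P X (order_stat_pdf n a m s) -> has_pdf P Y (gamma_pdf k s) ->
  (forall A B, measurable A -> measurable B ->
    P (X @^-1` A `&` Y @^-1` B) = P (X @^-1` A) * P (Y @^-1` B)) ->
  bowl_shaped L -> (forall t, (0 < t)%R -> derivable L t 1) ->
  measurable_fun setT Phi -> (forall z, 0 < Phi z)%R ->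
  \int[P]_w (L (Phi (X w / Y w) * Y w / s))%:E =
  \int[mu]_z cond_risk L k n a (m / s) (Phi z) z.
Proof.
move=> k0 s0 Xf Yg indXY bL dL mPhi Phi0.
rewrite (integral_loss_pos_part P Y L k s (fun w => Phi (X w / Y w)%R))//.
pose H (p : R * R) := (pos_part_loss L (Phi p.1 * p.2))%:E.
rewrite (ge0_expectation_ratio P X Y n a k m s H)//.
- apply/measurable_EFinP.
  apply: (measurableT_comp (measurable_pos_part_loss L dL)).
  by apply: measurable_funM => //; exact: measurableT_comp.
- by move=> p; rewrite lee_fin pos_part_loss_ge0.
Qed.

End ratio_estimators.

(** * Domination of the best affine equivariant estimator *)

Theorem corollary3p4 (R : realType) (n1 a1 b1 n2 a2 b2 : nat)
  (hpop1 : [&& (1 <= a1)%N, (a1 < b1)%N & (b1 <= n1)%N])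
  (hpop2 : [&& (1 <= a2)%N, (a2 < b2)%N & (b2 <= n2)%N])
  (d : measure_display) (T : measurableType d)
  (P : param R -> probability T R) (X1 X2 V1 V2 : {mfun T >-> R})
  (hmodel : censored_model n1 a1 b1 n2 a2 b2 P X1 X2 V1 V2)
  (L : R -> R)
  (hLdiff : forall t, 0 < t -> derivable L t 1)
  (hLbowl : bowl_shaped L)
  (hLreg : gamma_regular (b2 - a2) L)
  (c02 beta : R)
  (hc02 : unique_pos_root
    (fun c => gamma_mean (b2 - a2) (fun v => derive1 L (c * v) * v)) c02)
  (hbeta : unique_pos_root
    (fun b => gamma_mean (b2 - a2 + 2) (fun w => derive1 L (w * b))) beta)
  (hlt : beta < c02) :
  dominates P L (delta_2S2 n2 a2 c02 beta X2 V2) (delta_02 c02 V2).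
Proof.
have [c0 _ _] := hc02; have [b0 _ _] := hbeta.
have k_gt0 : (0 < b2 - a2)%N by rewrite subn_gt0; case/and3P: hpop2.
rewrite addn2 in hbeta; set k := (b2 - a2)%N in k_gt0 hLreg hbeta hmodel *.
(* With shape [k + 1], the critical-point equation has shape [k + 2], which is the one defining
   [beta]. *)
pose G c := gamma_mean k.+1 (fun v => L (c * v)).
have G_incr x y : beta <= x -> x < y -> G x < G y.
  move=> bx xy.
  apply: (gamma_mean_increasing hLdiff hLbowl hLreg k.+1 beta) => //;
    by rewrite in_itv/= ?bx// (le_trans bx (ltW xy)).
have G_ndecr x y : beta <= x -> x <= y -> G x <= G y.
  by move=> bx; rewrite le_eqVlt => /predU1P[->//|xy]; exact/ltW/G_incr.
pose M : R := (n2 - a2 + 1)%:R.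
have M0 : 0 < M by rewrite ltr0n addn1.
(* Both estimators have the form [phi (X2 / V2) * V2]: [phi] is [Phi] for [delta_2S2] and constant
   for [delta_02]. *)
pose Phi z := if 0 < z then Num.min c02 (beta * (1 + M * z)) else c02.
have mPhi : measurable_fun setT Phi.
  apply: measurable_fun_ifT => //; first exact: measurable_fun_ltr.
  apply: measurable_minr => //; apply: measurable_funM => //.
  by apply: measurable_funD => //; exact: measurable_funM.
have q_gt0 z : 0 < z -> 0 < 1 + M * z by move=> z0; rewrite addr_gt0// mulr_gt0.
have Phi0 z : 0 < Phi z.
  by rewrite /Phi; case: ifPn => // z0; rewrite lt_min c0 mulr_gt0 ?q_gt0.
have riskE th (phi : R -> R) :
    measurable_fun setT phi -> (forall z, 0 < phi z) ->
    risk P L th (fun w => phi (X2 w / V2 w) * V2 w) =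
    (\int[lebesgue_measure]_z
      cond_risk L k n2 a2 (mu2 th / sigma2 th) (phi z) z)%E.
  move=> mphi phi0; have [ind _ pdfX _ pdfV] := hmodel th.
  have s0 : 0 < sigma2 th := lt_le_trans (sigma1_gt0 th) (sigma1_le_sigma2 th).
  rewrite /risk unlock.
  apply: (integral_loss_ratio (P th) X2 V2) => // A B mA mB.
  (* Positions 1 and 3 of the tuple, counted from 0, hold [X2] and [V2]. *)
  exact: (mutually_independent_pair (P th) _
    (tnth [tuple X1 : T -> R; X2 : T -> R; V1 : T -> R; V2 : T -> R])
    (@Ordinal 4 1 isT) (@Ordinal 4 3 isT) A B isT ind mA mB).
have risk2E th : risk P L th (delta_2S2 n2 a2 c02 beta X2 V2) =
    (\int[lebesgue_measure]_z
      cond_risk L k n2 a2 (mu2 th / sigma2 th) (Phi z) z)%E.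
  rewrite -riskE//; congr (risk P L th _); apply/funext => w.
  by rewrite /delta_2S2 /Phi; case: ifP.
have risk0E th : risk P L th (delta_02 c02 V2) =
    (\int[lebesgue_measure]_z
      cond_risk L k n2 a2 (mu2 th / sigma2 th) c02 z)%E.
  by rewrite -(riskE th (fun=> c02)).
have G_div z : 0 < z -> beta * (1 + M * z) <= c02 ->
    G beta <= G (c02 / (1 + M * z)).
  by move=> z0 bz; apply: G_ndecr => //; rewrite ler_pdivlMr// q_gt0.
(* The multipliers differ only if [z > 0] and [beta * (1 + M * z) < c02]; there the lower bound 0 on
   the weight suffices. *)
have cond_le eta z : (cond_risk L k n2 a2 eta (Phi z) z
    <= cond_risk L k n2 a2 eta c02 z)%E.
  rewrite /Phi; case: ifPn => // z0; case: (leP c02) => // /ltW bz.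
  have /= := cond_risk_le L k k_gt0 hLdiff hLbowl hLreg n2 a2 eta beta c02 z 0.
  rewrite !mul0r !mulr0 adde0; apply => //; first exact: G_div.
  by move=> y _; have /andP[] := order_stat_weight_itv a2 eta y.
have mrisk eta phi : measurable_fun setT phi -> measurable_fun setT
    (fun z => cond_risk L k n2 a2 eta (phi z) z).
  exact: measurable_cond_risk.
split=> [th|].
  rewrite risk2E risk0E; apply: ge0_le_integral => //.
  - by move=> z _; exact: cond_risk_ge0.
  - exact: mrisk.
  - exact: (mrisk _ (fun=> c02)).
(* For [mu2 = -1] the weight is bounded away from 0, so the gap is strict. *)
exists (Param 0 (-1) ltr01 (lexx 1)).
set th := Param _ _ _ _.
(* A strict gap needs a finite risk; this one is the mean loss of [c02 * v] for shape [k]. *)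
have risk0_fin : (risk P L th (delta_02 c02 V2) < +oo)%E.
  have [_ _ _ _ pdfV] := hmodel th.
  rewrite /risk unlock (integral_loss_pos_part (P th) V2 L k _ (fun=> c02))//.
  pose H v := (pos_part_loss L (c02 * (v / 1)))%:E.
  have mH : measurable_fun setT H.
    apply/measurable_EFinP.
    apply: (measurableT_comp (measurable_pos_part_loss L hLdiff)).
    by apply: measurable_funM => //; exact: measurable_funM.
  have H0 v : (0 <= H v)%E by rewrite lee_fin pos_part_loss_ge0.
  rewrite -[X in (X < _)%E]
    (@ge0_integral_distribution _ _ _ _ _ (P th) V2 H mH H0).
  rewrite (ge0_integral_pdf (P th) V2 (gamma_pdf k 1))//; last 2 first.
  - exact: measurable_gamma_pdf.
  - by move=> v; exact: gamma_pdf_ge0.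
  have [int_c0 _ _] := hLreg k c02 (leqnn k) c0.
  apply: le_lt_trans (integrable_lty measurableT int_c0).
  rewrite le_eqVlt; apply/orP; left; apply/eqP; apply: eq_integral => v _.
  rewrite /H /pos_part_loss divr1 pmulr_rgt0// -EFinM; congr EFin.
  by case: ltP => // v0; rewrite gamma_pdf_le0// !mulr0.
(* Chosen so that [beta * q1] is the midpoint of [beta] and [c02]; thus [beta * (1 + M * z)] stays
   below [c02], by a fixed margin, on []0, z1]]. *)
pose z1 := (c02 / beta - 1) / (M + M).
pose q1 := 1 + M * z1.
have q1E : q1 = (c02 / beta + 1) / 2.
  by rewrite /q1 /z1; field; rewrite !gt_eqF// addr_gt0.
have bq1 : beta * q1 < c02.
  have -> : beta * q1 = (c02 + beta) / 2 by rewrite q1E; field; rewrite gt_eqF.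
  lra.
have z1_gt0 : 0 < z1.
  rewrite divr_gt0//; last exact: addr_gt0.
  by rewrite subr_gt0 ltr_pdivlMr// mul1r.
have q1_gt0 : 0 < q1 by exact: q_gt0.
(* The value at [y = 0] of the weight with [eta = -1], hence a lower bound for [y > 0]. *)
pose hmin : R := (1 - expR (-1)) ^+ (a2 - 1).
have e1 : 0 < 1 - expR (-1) :> R by rewrite subr_gt0 expR_lt1 oppr_lt0.
have hmin0 : 0 < hmin by rewrite exprn_gt0.
have hwt y : 0 < y -> hmin <= order_stat_weight a2 (-1) y.
  move=> y0; rewrite /order_stat_weight ifT; last first.
    by rewrite (lt_trans _ y0)// oppr_lt0.
  have ey : expR (- (y - -1)) <= expR (-1) :> R by rewrite ler_expR; lra.
  rewrite lerXn2r ?nnegrE ?(ltW e1)//; move: e1 ey; lra.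
(* A gap valid for all [z] in []0, z1]]: both the factor and [G (c02 / q)] are nonincreasing in [q]
   there, so [q1] is the worst case. *)
pose kappa :=
  cond_risk_factor k n2 a2 (-1) q1 * (hmin * (G (c02 / q1) - G beta)).
have Gq1 : 0 < G (c02 / q1) - G beta.
  by rewrite subr_gt0 G_incr// ltr_pdivlMr.
have kappa_gt0 : 0 < kappa.
  by rewrite /kappa mulr_gt0 ?cond_risk_factor_gt0// mulr_gt0.
have gap z : (cond_risk L k n2 a2 (-1) (Phi z) z
    + (kappa * \1_`]0, z1] z)%:E <= cond_risk L k n2 a2 (-1) c02 z)%E.
  rewrite indicE; have [|_] := boolP (z \in _); last first.
    by rewrite mulr0 adde0; exact: cond_le.
  rewrite inE/= in_itv/= mulr1 => /andP[z0 zz1].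
  have q0 := q_gt0 z z0.
  have qq1 : 1 + M * z <= q1 by rewrite lerD2l ler_pM2l.
  have bz : beta * (1 + M * z) <= c02.
    by rewrite (le_trans _ (ltW bq1))// ler_pM2l.
  rewrite /Phi z0 min_r//.
  have /= gap_z := cond_risk_le L k k_gt0 hLdiff hLbowl hLreg n2 a2 (-1) beta
    c02 z hmin z0 b0 bz (ltW hmin0) (G_div z z0 bz) hwt.
  apply: le_trans gap_z; rewrite leeD2l// lee_fin.
  apply: ler_pM.
  - exact/ltW/cond_risk_factor_gt0.
  - by rewrite mulr_ge0 ?(ltW hmin0) ?(ltW Gq1).
  - exact: cond_risk_factor_nincr.
  - rewrite ler_pM2l// lerD2r; apply: G_ndecr.
      by rewrite ler_pdivlMr// ltW.
    by rewrite ler_pM2l// lef_pV2.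
have risk_gap : (risk P L th (delta_2S2 n2 a2 c02 beta X2 V2)
    + (kappa * z1)%:E <= risk P L th (delta_02 c02 V2))%E.
  rewrite risk2E risk0E /= divr1.
  have -> : (kappa * z1)%:E = (\int[lebesgue_measure]_z
      (kappa * \1_`]0, z1] z)%:E)%E.
    under eq_integral do rewrite EFinM.
    rewrite ge0_integralZl//; last 2 first.
    - by apply/measurable_EFinP; exact: measurable_indic.
    - by rewrite lee_fin ltW.
    rewrite integral_indic// setIT EFinM; congr (_ * _)%E.
    by rewrite [RHS]lebesgue_measure_itv/= lte_fin z1_gt0 -EFinB subr0.
  have mind : measurable_fun setT (fun z => (kappa * \1_`]0, z1] z)%:E).
    by apply/measurable_EFinP/measurable_funM => //; exact: measurable_indic.
  have ind_ge0 z : (0 <= (kappa * \1_`]0, z1] z)%:E)%E.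
    by rewrite lee_fin mulr_ge0// ltW.
  rewrite -ge0_integralD//; last 2 first.
  - by move=> z _; exact: cond_risk_ge0.
  - exact: mrisk.
  apply: ge0_le_integral => //.
  - by move=> z _; rewrite adde_ge0//; exact: cond_risk_ge0.
  - by apply: emeasurable_funD => //; exact: mrisk.
  - exact: (mrisk _ (fun=> c02)).
have risk2_ge0 : (0 <= risk P L th (delta_2S2 n2 a2 c02 beta X2 V2))%E.
  by rewrite risk2E; apply: integral_ge0 => z _; exact: cond_risk_ge0.
have kz1 : (0 < (kappa * z1)%:E)%E by rewrite lte_fin mulr_gt0.
(* The risk of [delta_2S2] is itself finite by the same gap, so adding the positive [kappa * z1]
   increases it strictly. *)
apply: (lt_le_trans _ risk_gap); rewrite lteDl// ge0_fin_numE//.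
apply: le_lt_trans risk0_fin; apply: le_trans risk_gap.
by rewrite leeDl// ltW.
Qed.
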